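(* Let $\ell>0$ and assume that for every $y\in\mathbb{R}$ the map $t\mapsto \mathbb{P}_{\mathbf{X}}\left(p(y|\mathbf{X})\geq t\right)$ is continuous on $(0,\infty)$. Then the optimal predictor $\Gamma^*_\ell$, that is, the solution of the problem $$\min\left\{\mathbb{P}\left(Y\notin\Gamma(\mathbf{X})\right)\;:\;\Gamma \text{ a predictor with } \mathcal{L}(\Gamma)\leq \ell\right\},$$ can be expressed as $$\Gamma^*_\ell(\mathbf{X})=\{y\in\mathbb{R}:\ p(y|\mathbf{X})\geq\lambda^*_\ell\},$$ where $\lambda^*_\ell=G^{-1}(\ell)$ and $G(t)=\int_{\mathbb{R}}\mathbb{P}\left(p(y|\mathbf{X})\geq t\right)dy$ for $t>0$.
   Context: Model: $(\mathbf{X},Y)\in\mathbb{R}^d\times\mathbb{R}$ satisfies $Y=f^*(\mathbf{X})+\sigma(\mathbf{X})\varepsilon$, where $\varepsilon\sim\mathcal{N}(0,1)$ is independent of $\mathbf{X}$, and $f^*:\mathbb{R}^d\to\mathbb{R}$ and $\sigma:\mathbb{R}^d\to(0,\infty)$ are measurable. The conditional density of $Y$ given $\mathbf{X}=\mathbf{x}$ is $$p(y|\mathbf{x})=\frac{1}{\sqrt{2\pi}\,\sigma(\mathbf{x})}\exp\left(-\frac{(y-f^*(\mathbf{x}))^2}{2\sigma^2(\mathbf{x})}\right).$$ A predictor $\Gamma$ is a map from $\mathbb{R}^d$ to subsets of $\mathbb{R}$ such that $\{(\mathbf{x},y): y\in\Gamma(\mathbf{x})\}$ is measurable. Its expected length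 is $\mathcal{L}(\Gamma)=\mathbb{E}[L(\Gamma(\mathbf{X}))]=\mathbb{E}\left[\int_{\mathbb{R}}\mathbf{1}_{\{y\in\Gamma(\mathbf{X})\}}dy\right]$, where $L$ is Lebesgue measure. Optimal predictors are understood up to null sets. $\mathbb{P}_{\mathbf{X}}$ denotes the law of $\mathbf{X}$. For the nonincreasing function $G$, $G^{-1}$ is the generalized inverse $G^{-1}(\ell)=\inf\{t>0: G(t)\leq\ell\}$. *)

(* Defs.v *)
From HB Require Import structures.
From mathcomp Require Import all_boot all_order all_algebra.
From mathcomp Require Import all_classical all_reals all_analysis.

Set Implicit Arguments.
Unset Strict Implicit.
Unset Printing Implicit Defensive.

Import Order.TTheory GRing.Theory Num.Theory.
Import numFieldNormedType.Exports.

Local Open Scope classical_set_scope.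
Local Open Scope ring_scope.

(* The space R^d is [d.-tuple R], whose measurable sets are generated by the
   coordinate projections, i.e. are the Borel sets. *)

Definition independent_RVs d0 d1 d2 (Omega : measurableType d0)
    (T1 : measurableType d1) (T2 : measurableType d2) (R : realType)
    (P : probability Omega R) (X : {RV P >-> T1}) (Z : {RV P >-> T2}) : Prop :=
  forall (A : set T1) (B : set T2), measurable A -> measurable B ->
    P (X @^-1` A `&` Z @^-1` B) = (P (X @^-1` A) * P (Z @^-1` B))%E.

(* Laws are compared on measurable sets only: a pushforward has no meaningful
   value elsewhere. *)
Definition standard_normal d0 (Omega : measurableType d0) (R : realType)
    (P : probability Omega R) (eps : {RV P >-> R}) : Prop :=
  forall B : set R, measurable B -> distribution P eps B = normal_prob 0 1 B.

(* [cond_density f sigma y x] is p(y|x). *)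
Definition cond_density (R : realType) (d : nat) (f sigma : d.-tuple R -> R)
    (y : R) (x : d.-tuple R) : R :=
  (Num.sqrt (2 * pi) * sigma x)^-1 *
  expR (- ((y - f x) ^+ 2 / (2 * sigma x ^+ 2))).

Definition predictor (R : realType) (d : nat)
    (Gamma : d.-tuple R -> set R) : Prop :=
  measurable [set z : d.-tuple R * R | Gamma z.1 z.2].

Definition expected_length d0 (Omega : measurableType d0) (R : realType)
    (d : nat) (P : probability Omega R) (X : {RV P >-> d.-tuple R})
    (Gamma : d.-tuple R -> set R) : \bar R :=
  (\int[P]_w lebesgue_measure (Gamma (X w)))%E.

Definition error_prob d0 (Omega : measurableType d0) (R : realType)
    (d : nat) (P : probability Omega R) (X : {RV P >-> d.-tuple R})
    (Y : {RV P >-> R}) (Gamma : d.-tuple R -> set R) : \bar R :=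
  P [set w | ~ Gamma (X w) (Y w)].

Definition optimal_predictor d0 (Omega : measurableType d0) (R : realType)
    (d : nat) (P : probability Omega R) (X : {RV P >-> d.-tuple R})
    (Y : {RV P >-> R}) (l : R) (Gamma : d.-tuple R -> set R) : Prop :=
  [/\ predictor Gamma,
      (expected_length X Gamma <= l%:E)%E &
      forall Gamma' : d.-tuple R -> set R, predictor Gamma' ->
        (expected_length X Gamma' <= l%:E)%E ->
        (error_prob X Y Gamma <= error_prob X Y Gamma')%E].

(* Equality up to null sets of the product of the law of X and the Lebesgue
   measure. *)
Definition ae_eq_predictor d0 (Omega : measurableType d0) (R : realType)
    (d : nat) (P : probability Omega R) (X : {RV P >-> d.-tuple R})
    (Gamma1 Gamma2 : d.-tuple R -> set R) : Prop :=
  {ae (distribution P X \x @lebesgue_measure R)%E,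
    forall z : d.-tuple R * R, Gamma1 z.1 z.2 <-> Gamma2 z.1 z.2}.

Definition G_fun d0 (Omega : measurableType d0) (R : realType)
    (d : nat) (P : probability Omega R) (X : {RV P >-> d.-tuple R})
    (f sigma : d.-tuple R -> R) (t : R) : \bar R :=
  (\int[lebesgue_measure]_y P [set w | (t <= cond_density f sigma y (X w))%R])%E.

(* The infimum is taken in R. For [G = G_fun X f sigma], Tonelli and Markov
   give G t <= 1/t, so that the set is nonempty for every l > 0. *)
Definition gen_inverse (R : realType) (G : R -> \bar R) (l : R) : R :=
  inf [set t : R | 0 < t /\ (G t <= l%:E)%E].

Definition level_predictor (R : realType) (d : nat)
    (f sigma : d.-tuple R -> R) (lambda : R) : d.-tuple R -> set R :=
  fun x => [set y | lambda <= cond_density f sigma y x].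

(* Main.v *)
Require Import Defs.
From HB Require Import structures.
From mathcomp Require Import all_boot all_order all_algebra.
From mathcomp Require Import all_classical all_reals all_analysis.
From mathcomp Require Import measurable_realfun.
From mathcomp Require Import ring.

Set Implicit Arguments.
Unset Strict Implicit.
Unset Printing Implicit Defensive.

Import Order.TTheory GRing.Theory Num.Theory.
Import numFieldNormedType.Exports.

Local Open Scope classical_set_scope.
Local Open Scope ring_scope.

(** Let nu be the product of the law of X and Lebesgue measure, p(x, y) the
    conditional density, and identify a predictor with the subset of
    R^d x R of the pairs (x, y) such that y is in Gamma(x).  In these terms the
    problem is the Neyman-Pearson one: the expected length of S is nu(S)
    ([expected_length_product]), its coverage probability is the integral of p
    over S ([coverage_density]), so one wants the set of nu-measure at most l
    on which p has the largest integral.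

    A superlevel set A = {p >= lambda} solves it provided that nu(A) = l.
    Trading B \ A, where p < lambda, for A \ B, where p >= lambda, does not
    decrease the integral, because nu(B \ A) <= nu(A \ B) as soon as
    nu(B) <= nu(A) ([neyman_pearson]).  If B does as well as A, the trade is
    made at price lambda exactly, so that p = lambda almost everywhere on
    A \ B; when the level set {p = lambda} is null, A and B differ by a null
    set ([neyman_pearson_unique]).

    It remains to see that lambda = G^-1(l) gives measure exactly l
    ([superlevel_gen_inverse]).  By Tonelli G(t) = nu{p >= t}
    ([product_ysection]).  The continuity assumption says that for each y the
    law of p(y|X) has no atom in (0, +oo) ([continuous_superlevel_level0]), so
    that the level sets {p = t} are nu-null.  Hence G, always left-continuous
    where finite, is also right-continuous, and it takes the value l at lambda.
    Two more facts enter: G is finite on (0, +oo), by Markov's inequality, and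
    lambda > 0, because p is positive everywhere while nu has infinite mass, so
    that G(t) tends to +oo as t decreases to 0. *)

(** * The Neyman-Pearson lemma for superlevel sets *)

Section neyman_pearson.
Context d (T : measurableType d) (R : realType).
Variables (nu : {measure set T -> \bar R}) (p : T -> R).
Hypothesis mp : measurable_fun [set: T] p.
Hypothesis p_ge0 : forall x, 0 <= p x.

Local Notation Q S := (\int[nu]_(x in S) (p x)%:E)%E.
Local Notation superlevel t := [set x | t <= p x].

Lemma measurable_superlevel (t : R) : measurable (superlevel t).
Proof.
have -> : superlevel t = p @^-1` `[t, +oo[.
  by apply/seteqP; split => x /=; rewrite in_itv/= andbT.
by rewrite -[X in measurable X]setTI; exact: mp.
Qed.

Lemma measurable_level (t : R) : measurable [set x | p x = t].
Proof.
rewrite -[X in measurable X]setTI.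
exact: (mp measurableT (measurable_set1 t)).
Qed.

Lemma density_split A B : measurable A -> measurable B ->
  (Q A = Q (A `\` B) + Q (A `&` B))%E.
Proof.
move=> mA mB; rewrite -[in LHS](setUIDK A B) setUC.
rewrite ge0_integral_setU//.
- exact: measurableD.
- exact: measurableI.
- exact/measurable_EFinP/measurable_funTS.
- by move=> x _; rewrite lee_fin.
- by apply/disj_setPS => x -[] [_ nBx] [_ /nBx].
Qed.

Lemma density_ge_measure (t : R) D : 0 <= t -> measurable D ->
  D `<=` superlevel t -> (t%:E * nu D <= Q D)%E.
Proof.
move=> t0 mD Dt; rewrite -integral_cst//; apply: ge0_le_integral => //.
exact/measurable_EFinP/measurable_funTS.
Qed.

Lemma density_le_measure (t : R) D : 0 <= t -> measurable D ->
  D `<=` ~` superlevel t -> (Q D <= t%:E * nu D)%E.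
Proof.
move=> t0 mD Dt; rewrite -integral_cst//; apply: ge0_le_integral => //.
- by move=> x _; rewrite lee_fin.
- exact/measurable_EFinP/measurable_funTS.
- by move=> x /Dt /= /negP; rewrite lee_fin -ltNge => /ltW.
Qed.

Variable t : R.
Hypothesis t_gt0 : 0 < t.
Local Notation A := (superlevel t).
Hypothesis nuA_fin : (nu A < +oo)%E.
Variable B : set T.
Hypothesis mB : measurable B.
Hypothesis nuBA : (nu B <= nu A)%E.

(** Removing the common part A `&` B needs it to have finite measure; this is
    where the finiteness of nu A enters. *)
Lemma le_measure_diff : (nu (B `\` A) <= nu (A `\` B))%E.
Proof.
have mA := measurable_superlevel t.
have fI : nu (A `&` B) \is a fin_num.
  by rewrite ge0_fin_numE//; exact: le_lt_trans (measureIl nu mA mB) nuA_fin.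
move: nuBA; rewrite (measureDI nu mB mA) (measureDI nu mA mB) (setIC B).
by rewrite leeD2rE.
Qed.

Lemma density_diff_le : (Q (B `\` A) <= t%:E * nu (A `\` B))%E.
Proof.
have mA := measurable_superlevel t.
apply: (@le_trans _ _ (t%:E * nu (B `\` A))%E).
  apply: density_le_measure; [exact: ltW|exact: measurableD|].
  by move=> x [].
by rewrite lee_wpmul2l ?lee_fin ?(ltW t_gt0)// le_measure_diff.
Qed.

Lemma density_diff_ge : (t%:E * nu (A `\` B) <= Q (A `\` B))%E.
Proof.
have mA := measurable_superlevel t.
apply: density_ge_measure; [exact: ltW|exact: measurableD|].
by move=> x [].
Qed.

(** Both integrals share the part over A `&` B, and t times nu (A `\` B)
    separates the integrals over the two differences. *)
Lemma neyman_pearson : (Q B <= Q A)%E.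
Proof.
have mA := measurable_superlevel t.
rewrite (density_split mA mB) (density_split mB mA) (setIC B) leeD2r//.
exact: le_trans density_diff_le density_diff_ge.
Qed.

(** Equality of the integrals turns the two separating inequalities into
    equalities, so that the nonnegative function p - t has integral zero on
    A `\` B; it then vanishes almost everywhere there, inside a null level set.
    The other difference is null because it is at most as large. *)
Lemma neyman_pearson_unique : nu [set x | p x = t] = 0 -> (Q A < +oo)%E ->
  (Q A <= Q B)%E -> nu (A `\` B) = 0 /\ nu (B `\` A) = 0.
Proof.
move=> nut QA QAB.
have mA := measurable_superlevel t.
have mAB : measurable (A `\` B) by exact: measurableD.
have fI : Q (A `&` B) \is a fin_num.
  rewrite ge0_fin_numE; last by apply: integral_ge0 => x _; rewrite lee_fin.
  apply: le_lt_trans QA; apply: ge0_subset_integral => //.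
  - exact: measurableI.
  - exact/measurable_EFinP/measurable_funTS.
  - by move=> x _; rewrite lee_fin.
have nuAB_fin : (nu (A `\` B) < +oo)%E.
  by apply: le_lt_trans nuA_fin; rewrite le_measure ?inE.
have QABt : (Q (A `\` B) <= t%:E * nu (A `\` B))%E.
  apply: le_trans density_diff_le; move: QAB.
  rewrite (density_split mA mB) (density_split mB mA) (setIC B).
  by rewrite leeD2rE.
have nuAB : nu (A `\` B) = 0.
  have mpt : measurable_fun (A `\` B) (fun x => (p x - t)%:E).
    apply/measurable_EFinP/measurable_funTS/measurable_funB => //.
  have pt0 x : (A `\` B) x -> (0 <= (p x - t)%:E)%E.
    by case=> /= tp _; rewrite lee_fin subr_ge0.
  have Q0 : (\int[nu]_(x in A `\` B) `|(p x - t)%:E| = 0)%E.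
    apply/eqP; rewrite eq_le integral_ge0// andbT.
    rewrite (eq_integral (fun x => (p x - t)%:E)); last first.
      by move=> x; rewrite inE => /pt0 /gee0_abs.
    (* The integral of p - t is compared to 0 after adding back the finite
       integral of t, which avoids any subtraction of integrals. *)
    have tn : (t%:E * nu (A `\` B))%E \is a fin_num.
      by rewrite fin_numM// ge0_fin_numE.
    rewrite -(@leeD2rE _ (t%:E * nu (A `\` B)))// add0e.
    rewrite -integral_cst// -ge0_integralD//; last first.
      by move=> x _; rewrite lee_fin ltW.
    rewrite integral_cst//.
    by under eq_integral do rewrite /= -EFinD subrK.
  have [N [mN N0 subN]] := (ae_eq_integral_abs nu mAB mpt).1 Q0.
  have mE := measurable_level t.
  apply: (@subset_measure0 _ _ _ nu _ (N `|` [set x | p x = t])) => //.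
  - exact: measurableU.
  - move=> x ABx; have [pxt|pxt] := eqVneq (p x) t; [by right|left].
    by apply: subN => /= /(_ ABx) -[] /subr0_eq; exact/eqP.
  - by apply: null_set_setU.
split=> //; apply/eqP; rewrite eq_le measure_ge0 andbT.
by rewrite -[X in (_ <= X)%E]nuAB le_measure_diff.
Qed.

End neyman_pearson.

(** * The generalized inverse of the measure of superlevel sets *)

Section superlevel_measure.
Context d (T : measurableType d) (R : realType).
Variables (nu : {measure set T -> \bar R}) (p : T -> R).
Hypothesis mp : measurable_fun [set: T] p.
Hypothesis p_gt0 : forall x, 0 < p x.
Let p_ge0 x : 0 <= p x. Proof. exact: ltW. Qed.
Local Notation superlevel t := [set x | t <= p x].
Local Notation H t := (nu (superlevel t)).

Lemma superlevel_measure_nonincreasing (s t : R) :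
  s <= t -> (H t <= H s)%E.
Proof.
move=> st; rewrite le_measure ?inE//; [exact: measurable_superlevel..|].
by move=> x /=; exact: le_trans.
Qed.

Hypothesis p_int : (\int[nu]_x (p x)%:E <= 1)%E.

Lemma markov_superlevel (t : R) : 0 < t -> (H t <= t^-1%:E)%E.
Proof.
move=> t0; have mA := measurable_superlevel mp t.
rewrite -(@lee_pmul2l _ t%:E)// -EFinM divff ?gt_eqF//.
apply: le_trans p_int.
apply: (@le_trans _ _ (\int[nu]_(x in superlevel t) (p x)%:E)%E).
  by apply: density_ge_measure => //; exact: ltW.
apply: ge0_subset_integral => //; first exact/measurable_EFinP.
by move=> x _; rewrite lee_fin.
Qed.

Lemma superlevel_measure_fin (t : R) : 0 < t -> (H t < +oo)%E.
Proof. by move=> t0; rewrite (le_lt_trans (markov_superlevel t0))// ltry. Qed.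

Hypothesis nu_infinite : nu [set: T] = +oo%E.
Hypothesis nu_level0 : forall t : R, 0 < t -> nu [set x | p x = t] = 0.

Variable l : R.
Hypothesis l_gt0 : 0 < l.
Local Notation S := [set t : R | 0 < t /\ (H t <= l%:E)%E].

Let S_has_inf : has_inf S.
Proof.
split; last by exists 0 => t [/ltW].
exists l^-1; split; first by rewrite invr_gt0.
by rewrite (le_trans (markov_superlevel _)) ?invr_gt0// invrK.
Qed.

Local Notation lam := (gen_inverse (fun t => H t) l).

Let above_lam t : lam < t -> (H t <= l%:E)%E.
Proof.
move=> lt; have [] := inf_adherent (eps := t - lam) _ S_has_inf.
  by rewrite subr_gt0.
move=> s [s0 Hs]; rewrite -/(gen_inverse (fun t => H t) l) addrC subrK => st.
by apply: le_trans Hs; apply: superlevel_measure_nonincreasing; exact: ltW.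
Qed.

Let below_lam (t : R) : 0 < t -> t < lam -> (l%:E < H t)%E.
Proof.
move=> t0; apply: contraTT; rewrite -!leNgt => Ht.
by apply: ge_inf; [exact: S_has_inf.2|].
Qed.

Let harmonic_gt0 n : 0 < n.+1%:R^-1 :> R.
Proof. by rewrite invr_gt0. Qed.

Let superlevel_union (s : R) :
  [set x | s < p x] = \bigcup_n superlevel (s + n.+1%:R^-1).
Proof.
apply/seteqP; split => [x /= sp|x [n _ /=]].
  have [n _ /(_ n (leqnn n))] : \forall n \near \oo, n.+1%:R^-1 < p x - s :> R.
    by apply: (@near_infty_natSinv_lt _ (PosNum _)); rewrite subr_gt0.
  by move=> np; exists n => //=; rewrite addrC -lerBrDr ltW.
by apply: lt_le_trans; rewrite ltrDl.
Qed.

(** Continuity from below: a bound on the measures for all t > s passes to the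
    strict superlevel set at s, even when nu {p >= s} is infinite. *)
Lemma strict_superlevel_le (s c : R) :
  (forall t, s < t -> (H t <= c%:E)%E) -> (nu [set x | (s < p x)%R] <= c%:E)%E.
Proof.
move=> Hc; rewrite superlevel_union.
have mF n : measurable (superlevel (s + n.+1%:R^-1)).
  exact: measurable_superlevel.
have cvF : (nu \o (fun n => superlevel (s + n.+1%:R^-1))) @ \oo -->
    nu (\bigcup_n superlevel (s + n.+1%:R^-1)).
  apply: nondecreasing_cvg_mu => //; first exact: bigcup_measurable.
  move=> m n mn; apply/subsetPset => x /=; apply: le_trans.
  by rewrite lerD2l lef_pV2 ?posrE// ler_nat.
apply: (cvge_to_le cvF); near=> n.
by apply: Hc; rewrite ltrDl.
Unshelve. all: by end_near. Qed.

(** If lam were 0, every {p >= t} with t > 0 would have measure at most l, hence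
    so would {p > 0}, which is the whole space. *)
Lemma gen_inverse_gt0 : 0 < lam.
Proof.
have lam0 : 0 <= lam by apply: lb_le_inf; [exact: S_has_inf.1|move=> t [/ltW]].
rewrite lt_neqAle lam0 andbT; apply/eqP => lamE.
have : (nu [set x | (0 < p x)%R] <= l%:E)%E.
  by apply: strict_superlevel_le => t; rewrite {1}lamE; exact: above_lam.
have -> : [set x | 0 < p x] = setT.
  by apply/seteqP; split => // x _; exact: p_gt0.
by rewrite nu_infinite.
Qed.

(** The bound from above comes from thresholds t > lam by continuity from below,
    at the cost of the null level set {p = lam}; the bound from below comes from
    thresholds t < lam by continuity from above, which needs the measures to be
    finite. *)
Lemma superlevel_gen_inverse : H lam = l%:E.
Proof.
have lam0 := gen_inverse_gt0.
have mstrict : measurable [set x | lam < p x].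
  have -> : [set x | lam < p x] = p @^-1` `]lam, +oo[.
    by apply/seteqP; split => x /=; rewrite in_itv/= andbT.
  by rewrite -[X in measurable X]setTI; exact: mp.
apply/eqP; rewrite eq_le; apply/andP; split.
  have -> : superlevel lam = [set x | lam < p x] `|` [set x | p x = lam].
    apply/seteqP; split => [x /=|x /= [/ltW//|->//]].
    by rewrite le_eqVlt => /predU1P[->|]; [right|left].
  rewrite measureU0 ?nu_level0//; last exact: measurable_level.
  by apply: strict_superlevel_le => t; exact: above_lam.
(* The thresholds s n increase to lam and stay positive, even for n = 0. *)
pose s n := lam - lam * n.+2%:R^-1.
have s_lt n : s n < lam by rewrite /s ltrBlDr ltrDl mulr_gt0// invr_gt0.
have s_gt0 n : 0 < s n.
  by rewrite /s subr_gt0 -[ltRHS]mulr1 ltr_pM2l// invf_lt1// ltr1n.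
have capE : superlevel lam = \bigcap_n superlevel (s n).
  apply/seteqP; split => [x /= lp n _ /=|x xs /=].
    exact: le_trans (ltW (s_lt n)) lp.
  apply/ler_addgt0Pr => e e0.
  have [n _ /(_ n (leqnn n))] : \forall n \near \oo, n.+1%:R^-1 < e / lam :> R.
    by apply: (@near_infty_natSinv_lt _ (PosNum _)); rewrite divr_gt0.
  rewrite ltr_pdivlMr// mulrC => ne.
  rewrite -lerBlDr; apply: le_trans (xs n I); rewrite /s lerD2l lerN2.
  apply: le_trans (ltW ne); rewrite ler_pM2l// lef_pV2 ?posrE// ler_nat.
  by [].
have cvF : (nu \o (fun n => superlevel (s n))) @ \oo --> nu (superlevel lam).
  rewrite [in X in _ --> X]capE.
  apply: nonincreasing_cvg_mu; first exact: superlevel_measure_fin.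
  - by move=> n; exact: measurable_superlevel.
  - by rewrite -capE; exact: measurable_superlevel.
  - move=> m n mn; apply/subsetPset => x /=; apply: le_trans.
    by rewrite /s lerD2l lerN2 ler_pM2l// lef_pV2 ?posrE// ler_nat ltnS.
apply: (cvge_to_ge cvF); near=> n.
by rewrite ltW// below_lam.
Unshelve. all: by end_near. Qed.

End superlevel_measure.

(** * Affine images of the standard normal law *)

Section affine_normal.
Context (R : realType) (m s : R).
Hypothesis s_gt0 : 0 < s.
Local Notation affine := (fun e : R => m + s * e).
Local Notation leb := (@lebesgue_measure R).
Local Notation k := (NngNum (ltW s_gt0)).

Lemma measurable_affine : measurable_fun [set: R] affine.
Proof. by apply: measurable_funD => //; exact: measurable_funM. Qed.

(** The pushforward is a measure only along a measurable map, and this side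
    condition cannot be found by unification, so the structure is given by
    name. *)
Let affine_image : {measure set (measurableTypeR R) -> \bar R} :=
  @measure_function_pushforward__canonical__measure_function_Measure
    _ _ (measurableTypeR R) (measurableTypeR R) R leb affine measurable_affine.

(** The right-hand side is s times the Lebesgue measure of the preimage of A.
    Both sides are measures that agree on half-open intervals. *)
Lemma lebesgue_measure_affine (A : set R) : measurable A ->
  leb A = mscale k affine_image A.
Proof.
apply: lebesgue_measure_unique => _ [[a b] _ <-].
transitivity (s%:E * leb (affine @^-1` `]a, b]))%E => //.
have -> : affine @^-1` `]a, b] = `](a - m) / s, (b - m) / s]%classic.
  apply/seteqP; split => x /=; rewrite !in_itv/= ltr_pdivrMr// ler_pdivlMr//;
    by rewrite ltrBlDl lerBrDl (mulrC x).
rewrite !lebesgue_measure_itv/= !lte_fin ltr_pM2r ?invr_gt0// ltrD2r.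
case: ifPn => _; last by rewrite mule0.
rewrite -!EFinB -EFinM; congr EFin.
by field; rewrite gt_eqF.
Qed.

Lemma normal_prob_affine (A : set R) : measurable A ->
  normal_prob 0 1 (affine @^-1` A) = normal_prob m s A.
Proof.
move=> mA; have mf := measurable_affine.
rewrite /normal_prob.
have mpdf : measurable_fun A (fun x => (normal_pdf m s x)%:E).
  apply/measurable_EFinP; apply: measurable_funTS.
  exact: measurable_normal_pdf.
rewrite [RHS](eq_measure_integral (mscale k affine_image)); last first.
  by move=> B mB _; exact: lebesgue_measure_affine.
rewrite ge0_integral_mscale//; last first.
  by move=> x _; rewrite lee_fin normal_pdf_ge0.
rewrite ge0_integral_pushforward//; last first.
  by move=> x _; rewrite lee_fin normal_pdf_ge0.
rewrite -ge0_integralZl//=; first last.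
- by rewrite lee_fin ltW.
- by move=> x _; rewrite lee_fin normal_pdf_ge0.
- apply/measurable_EFinP; apply: measurable_funTS.
  apply: measurableT_comp => //.
  exact: measurable_normal_pdf.
- by rewrite -[X in measurable X]setTI; exact: mf.
apply: eq_integral => x _; rewrite -EFinM; congr EFin.
rewrite !normal_pdfE ?gt_eqF// /normal_peak /normal_fun.
rewrite mulrA; congr (_ * expR _); last by field; rewrite gt_eqF.
rewrite expr1n mul1r -mulrnAr sqrtrM ?sqr_ge0// sqrtr_sqr gtr0_norm//.
by rewrite invfM mulrA divff ?mul1r// gt_eqF.
Qed.

End affine_normal.

Lemma cond_density_normal_pdf (R : realType) (d : nat)
    (f sigma : d.-tuple R -> R) y x : 0 < sigma x ->
  cond_density f sigma y x = normal_pdf (f x) (sigma x) y.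
Proof.
move=> s0; rewrite normal_pdfE ?gt_eqF// /normal_peak /normal_fun /cond_density.
congr (_ ^-1 * expR _); last by rewrite mulNr mulr_natl.
rewrite -mulrnAr [in RHS]sqrtrM ?sqr_ge0// sqrtr_sqr gtr0_norm// [LHS]mulrC.
by rewrite mulr_natl.
Qed.

(** * Consequences of the probabilistic assumptions *)

(** For s > t the sets {q >= s} and {q = t} are disjoint and contained in
    {q >= t}; letting s decrease to t leaves no mass for {q = t}. *)
Lemma continuous_superlevel_level0 d (T : measurableType d) (R : realType)
    (mu : probability T R) (q : T -> R) (t : R) :
  measurable_fun [set: T] q ->
  {within `]0, +oo[, continuous (fun t : R => mu [set x | t <= q x])} ->
  0 < t -> mu [set x | q x = t] = 0.
Proof.
move=> mq cq t0.
have mlevel : measurable [set x | q x = t] := measurable_level mq t.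
have ct : mu [set x | s <= q x] @[s --> t^'+] --> mu [set x | t <= q x].
  apply: cvg_at_right_filter; move: cq.
  rewrite continuous_open_subspace; last exact: interval_open.
  by apply; rewrite inE/= in_itv/= t0.
have ft A : measurable A -> mu A \is a fin_num.
  by move=> mA; exact: fin_num_measure.
have mt s : measurable [set x | s <= q x] by exact: measurable_superlevel.
have : (mu [set x | (t <= q x)%R] <=
    mu [set x | (t <= q x)%R] - mu [set x | q x = t])%E.
  apply: (cvge_to_le ct); near=> s.
  rewrite leeBrDr ?ft// -measureU//.
  - rewrite le_measure ?inE//; first exact: measurableU.
    move=> x /= [sq|->//]; apply: le_trans sq.
    by apply: ltW; near: s; exact: nbhs_right_gt.
  - apply/seteqP; split => // x /= [sq qt]; move: sq; rewrite qt leNgt.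
    by move/negP; apply; near: s; exact: nbhs_right_gt.
rewrite leeBrDr ?ft// -[leRHS]adde0 leeD2lE ?ft// => mu0.
by apply/eqP; rewrite eq_le mu0 measure_ge0.
Unshelve. all: by end_near. Qed.

(** By independence the law of the pair agrees with the product measure on
    rectangles, and these determine it. *)
Lemma joint_law d0 d1 d2 (Omega : measurableType d0)
    (T1 : measurableType d1) (T2 : measurableType d2) (R : realType)
    (P : probability Omega R) (X : {RV P >-> T1}) (Z : {RV P >-> T2}) :
  independent_RVs X Z -> forall S, measurable S ->
  P [set w | S (X w, Z w)] = (distribution P X \x distribution P Z)%E S.
Proof.
move=> indep S mS.
pose XZ : {mfun Omega >-> (T1 * T2)%type} :=
  HB.pack (fun w => (X w, Z w)) (isMeasurableFun.Build _ _ _ _ _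
    (measurable_fun_pair (measurable_funP X) (measurable_funP Z))).
apply/esym; apply: (product_measure_unique (m' := distribution P XZ)).
- exact: indep.
- exact: mS.
Qed.

(** * Length and coverage in the Gaussian model *)

Section gaussian_model.
Context (R : realType) (d : nat) (d0 : measure_display).
Context (Omega : measurableType d0) (P : probability Omega R).
Context (X : {RV P >-> d.-tuple R}) (f sigma : {mfun d.-tuple R >-> R}).
Hypothesis sigma_gt0 : forall x, 0 < sigma x.

Local Notation mu := (distribution P X).
Local Notation leb := (@lebesgue_measure R).
Local Notation nu := (mu \x leb)%E.
Local Notation p := (fun z : d.-tuple R * R => cond_density f sigma z.2 z.1).

Lemma measurable_cond_density : measurable_fun [set: d.-tuple R * R] p.
Proof.
(* Inversion is measurable as the real power of exponent -1, which agrees with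
   it on positive numbers. *)
have minv (g : d.-tuple R * R -> R) : (forall z, 0 < g z) ->
    measurable_fun setT g -> measurable_fun setT (fun z => (g z)^-1).
  move=> g0 mg; rewrite (_ : (fun z => _) = (fun z => g z `^ (-1))); last first.
    by apply/funext => z; rewrite powR_inv1// ltW.
  by apply: (measurableT_comp (measurable_powR _)) mg.
have mf1 : measurable_fun setT (fun z : d.-tuple R * R => f z.1).
  exact: measurableT_comp measurable_fst.
have ms1 : measurable_fun setT (fun z : d.-tuple R * R => sigma z.1).
  exact: measurableT_comp measurable_fst.
rewrite /cond_density; apply: measurable_funM.
  apply: minv; last exact: measurable_funM.
  by move=> z; rewrite mulr_gt0// sqrtr_gt0 mulr_gt0// pi_gt0.
apply: measurableT_comp => //; apply: measurableT_comp => //.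
apply: measurable_funM.
  by apply: measurable_funX; exact: measurable_funB.
apply: minv; first by move=> z; rewrite mulr_gt0// exprn_gt0.
by apply: measurable_funM => //; exact: measurable_funX.
Qed.

Lemma cond_density_gt0 z : 0 < p z.
Proof.
by rewrite mulr_gt0 ?expR_gt0// invr_gt0 mulr_gt0// sqrtr_gt0 mulr_gt0// pi_gt0.
Qed.

Local Notation mp := measurable_cond_density.

(** Tonelli, once p(.|x) is recognised as the density of the normal law of mean
    f(x) and standard deviation sigma(x). *)
Lemma density_product (S : set (d.-tuple R * R)) : measurable S ->
  (\int[nu]_(z in S) (p z)%:E =
   \int[mu]_x normal_prob (f x) (sigma x) (xsection S x))%E.
Proof.
move=> mS; rewrite integral_mkcond fubini_tonelli1/=.
- apply: eq_integral => x _; rewrite /fubini_F /normal_prob.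
  rewrite [RHS]integral_mkcond.
  apply: eq_integral => y _; rewrite !patchE mem_xsection.
  by case: ifPn => // _; rewrite cond_density_normal_pdf.
- apply/(measurable_restrictT _ mS)/measurable_EFinP/measurable_funTS.
  exact: mp.
- move=> z; rewrite erestrict_ge0// => y _.
  by rewrite lee_fin ltW// cond_density_gt0.
Qed.

Lemma density_total : (\int[nu]_z (p z)%:E = 1)%E.
Proof.
rewrite density_product//.
rewrite (eq_integral (cst 1%E)).
  by rewrite integral_cst// mul1e; exact: probability_setT.
move=> x _; rewrite xsectionE preimage_setT.
exact: probability_setT.
Qed.

Lemma product_infinite : nu [set: d.-tuple R * R] = +oo%E.
Proof.
have lebT : leb [set: R] = +oo%E by rewrite -set_itvNyy lebesgue_measure_itv.
have muT : mu [set: d.-tuple R] = 1%E by exact: probability_setT.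
by rewrite -setXTT product_measure1E//= muT lebT mul1e.
Qed.

(** Applied to a superlevel set of p, this identifies its nu-measure with G. *)
Lemma product_ysection (S : set (d.-tuple R * R)) : measurable S ->
  nu S = (\int[leb]_y P [set w | S (X w, y)])%E.
Proof.
move=> mS; transitivity ((mu \x^ leb)%E S).
  by apply: product_measure_unique => //= A B mA mB; rewrite product_measure2E.
by apply: eq_integral => y _; rewrite /= ysectionE.
Qed.

Lemma expected_length_product (Gamma : d.-tuple R -> set R) :
  predictor Gamma ->
  expected_length X Gamma = nu [set z | Gamma z.1 z.2].
Proof.
move=> mG; rewrite /expected_length.
rewrite -(@ge0_integral_distribution _ _ _ _ _ P X (fun x => leb (Gamma x)))//.
- by apply: eq_integral => x _; rewrite /= xsectionE.
- rewrite (_ : (fun x => _) = leb \o xsection [set z | Gamma z.1 z.2]).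
    exact: measurable_fun_xsection.
  by apply/funext => x; rewrite /= xsectionE.
Qed.

Section error.
Variables Y eps : {RV P >-> R}.
Hypothesis eps_normal : standard_normal eps.
Hypothesis eps_indep : independent_RVs X eps.
Hypothesis Y_def : forall w, Y w = f (X w) + sigma (X w) * eps w.

(** Membership of (X, Y) in S is an event on the pair (X, eps), whose law is a
    product; given X = x, it is the event that f(x) + sigma(x) eps falls in the
    section of S at x. *)
Lemma coverage_density (S : set (d.-tuple R * R)) : measurable S ->
  P [set w | S (X w, Y w)] = (\int[nu]_(z in S) (p z)%:E)%E.
Proof.
move=> mS.
pose Phi (z : d.-tuple R * R) := (z.1, f z.1 + sigma z.1 * z.2).
have mPhi : measurable_fun [set: d.-tuple R * R] Phi.
  apply: measurable_fun_pair; first exact: measurable_fst.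
  apply: measurable_funD; first exact: measurableT_comp measurable_fst.
  apply: measurable_funM; last exact: measurable_snd.
  exact: measurableT_comp measurable_fst.
have mPS : measurable (Phi @^-1` S).
  by rewrite -[X in measurable X]setTI; exact: mPhi.
have -> : [set w | S (X w, Y w)] = [set w | (Phi @^-1` S) (X w, eps w)].
  by apply/funext => w /=; rewrite Y_def.
rewrite (joint_law eps_indep)// density_product//.
apply: eq_integral => x _ /=.
rewrite eps_normal; last exact: measurable_xsection.
rewrite -[RHS]normal_prob_affine//; exact: measurable_xsection.
Qed.

Lemma error_prob_density (Gamma : d.-tuple R -> set R) : predictor Gamma ->
  error_prob X Y Gamma =
  (1 - \int[nu]_(z in [set z | Gamma z.1 z.2]) (p z)%:E)%E.
Proof.
move=> mG; rewrite -coverage_density// -probability_setC//.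
have mXY : measurable_fun setT (fun w => (X w, Y w)).
  exact: measurable_fun_pair.
by rewrite -[X in measurable X]setTI; apply: mXY.
Qed.

End error.

End gaussian_model.

(** * The optimal predictor *)

Theorem proposition1 (R : realType) (d : nat)
  (d0 : measure_display) (Omega : measurableType d0) (P : probability Omega R)
  (X : {RV P >-> d.-tuple R}) (Y eps : {RV P >-> R})
  (f sigma : {mfun d.-tuple R >-> R})
  (sigma_gt0 : forall x, 0 < sigma x)
  (eps_normal : standard_normal eps)
  (eps_indep : independent_RVs X eps)
  (Y_def : forall w, Y w = f (X w) + sigma (X w) * eps w)
  (l : R) (l_gt0 : 0 < l)
  (p_cont : forall y : R,
     {within `]0, +oo[, continuous (fun t : R =>
        distribution P X [set x | t <= cond_density f sigma y x])}) :
  let lambda := gen_inverse (G_fun X f sigma) l in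
  let Gamma_star := level_predictor f sigma lambda in
  optimal_predictor X Y l Gamma_star /\
  (forall Gamma : d.-tuple R -> set R,
     optimal_predictor X Y l Gamma -> ae_eq_predictor X Gamma Gamma_star).
Proof.
move=> lambda Gamma_star.
pose nu := (distribution P X \x @lebesgue_measure R)%E.
pose p (z : d.-tuple R * R) := cond_density f sigma z.2 z.1.
pose Q (Gamma : d.-tuple R -> set R) :=
  (\int[nu]_(z in [set z | Gamma z.1 z.2]) (p z)%:E)%E.
have mp : measurable_fun setT p := measurable_cond_density f sigma_gt0.
have p_gt0 : forall z, 0 < p z := cond_density_gt0 f sigma_gt0.
have p_ge0 z : 0 <= p z by exact: ltW.
have p_int : (\int[nu]_z (p z)%:E = 1)%E := density_total X f sigma_gt0.
have nu_level0 (t : R) : 0 < t -> nu [set z | p z = t] = 0.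
  move=> t0; rewrite /nu product_ysection; last exact: (measurable_level mp).
  apply: integral0_eq => y _.
  apply: continuous_superlevel_level0 (p_cont y) t0.
  exact: (measurable_fun_pair1 y mp).
have GE : G_fun X f sigma = fun t => nu [set z | t <= p z].
  apply/funext => t; rewrite /nu product_ysection//.
  exact: measurable_superlevel.
have lambda_gt0 : 0 < lambda.
  rewrite /lambda GE; apply: gen_inverse_gt0 => //.
  - by rewrite p_int.
  - exact: product_infinite.
have nu_star : nu [set z | lambda <= p z] = l%:E.
  rewrite /lambda GE; apply: superlevel_gen_inverse => //.
  - by rewrite p_int.
  - exact: product_infinite.
have mstar : predictor Gamma_star by exact: measurable_superlevel.
have errorE Gamma : predictor Gamma -> error_prob X Y Gamma = (1 - Q Gamma)%E.
  exact: (error_prob_density sigma_gt0 eps_normal eps_indep Y_def).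
have lengthE Gamma : predictor Gamma ->
    expected_length X Gamma = nu [set z | Gamma z.1 z.2].
  exact: expected_length_product.
have Q_fin Gamma : predictor Gamma -> Q Gamma \is a fin_num.
  move=> mG; rewrite ge0_fin_numE; last first.
    by apply: integral_ge0 => z _; rewrite lee_fin.
  apply: (@le_lt_trans _ _ 1%E); last exact: ltry.
  rewrite -p_int; apply: ge0_subset_integral => //.
  - exact/measurable_EFinP.
  - by move=> z _; rewrite lee_fin.
have star_length : (expected_length X Gamma_star <= l%:E)%E.
  by rewrite lengthE// nu_star.
have nu_star_fin : (nu [set z | (lambda <= p z)%R] < +oo)%E.
  by rewrite nu_star ltry.
have nu_le Gamma : predictor Gamma -> (expected_length X Gamma <= l%:E)%E ->
    (nu [set z | Gamma z.1 z.2] <= nu [set z | (lambda <= p z)%R])%E.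
  by move=> mG; rewrite lengthE// nu_star.
split.
  split=> // Gamma mG lG; rewrite !errorE// leeB//.
  by apply: neyman_pearson => //; exact: nu_le.
move=> Gamma [mG lG /(_ _ mstar star_length)].
rewrite !errorE// leeD2lE// leeN2 => QG.
have Q_star_fin : (Q Gamma_star < +oo)%E by rewrite ltey_eq Q_fin.
have [starG Gstar] := neyman_pearson_unique
  (nu := (distribution P X \x lebesgue_measure)%E) mp p_ge0 lambda_gt0
  nu_star_fin mG (nu_le _ mG lG) (nu_level0 _ lambda_gt0) Q_star_fin QG.
exists (([set z | lambda <= p z] `\` [set z | Gamma z.1 z.2]) `|`
        ([set z | Gamma z.1 z.2] `\` [set z | lambda <= p z])); split.
- by apply: measurableU; exact: measurableD.
- by apply: null_set_setU => //; exact: measurableD.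
- move=> z /= Gz; have [GGz|nGz] := pselect (Gamma z.1 z.2).
    by right; split=> // pz; apply: Gz.
  by left; split=> //; apply: contrapT => pz; apply: Gz.
Qed.
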